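(* Let $X$ be a real normed space, let $\Omega\subset X$ be a nonempty closed set and let $F\subset X$ be a nonempty closed bounded convex set with $F\ne\{0\}$. Let $\bar x\notin\Omega$ and $r:=T_\Omega^F(\bar x)<\infty$. Then for any $\varepsilon\ge0$ satisfying $1-2\varepsilon\|F\|>0$ and any $x^*\in\widehat N_\varepsilon(\bar x;\Omega_r)\cap S_\varepsilon^*$, there exists a constant $\ell:=1+2\kappa\|F\|$ with $\kappa>\|x^*\|$ such that $$x^*\in\widehat\partial_{\ell\varepsilon}T_\Omega^F(\bar x).$$
   Context: $X^*$ is the dual of $X$ with pairing $\langle x^*,x\rangle=x^*(x)$. The minimal time function is $$T_\Omega^F(x)=\inf\{t\ge0:(x+tF)\cap\Omega\ne\emptyset\},\quad x\in X,$$ with $\inf\emptyset=\infty$. For $r>0$, $\Omega_r=\{x\in X:T_\Omega^F(x)\le r\}$. (For $\bar x\notin\Omega$ one has $T_\Omega^F(\bar x)>0$.) $\|F\|=\sup\{\|q\|:q\in F\}$, $\sigma_F(x^* )=\sup_{x\in F}\langle x^*,x\rangle$ for $x^*\in X^*$, and for $\varepsilon\ge0$ $$S_\varepsilon^*=\{x^*\in X^*:1-\varepsilon\|F\|\le\sigma_F(-x^* )\le1+\varepsilon\|F\|\}.$$ For $A\subset X$, $x\in A$ and $\varepsilon\ge0$, the set of $\varepsilon$-normals is $$\widehat N_\varepsilon(x;A)=\Big\{x^*\in X^*:\limsup_{u\to x,\,u\in A}\frac{\langle x^*,u-x\rangle}{\|u-x\|}\le\varepsilon\Big\}.$$ For $f\colon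 X\to(-\infty,\infty]$, $\bar x$ with $f(\bar x)<\infty$ and $\varepsilon\ge0$, the $\varepsilon$-Fréchet subdifferential is $$\widehat\partial_\varepsilon f(\bar x)=\Big\{x^*\in X^*:\liminf_{x\to\bar x}\frac{f(x)-f(\bar x)-\langle x^*,x-\bar x\rangle}{\|x-\bar x\|}\ge-\varepsilon\Big\}.$$ *)

(* Defs.v *)
From HB Require Import structures.
From mathcomp Require Import all_boot all_order all_algebra.
From mathcomp Require Import all_classical all_reals all_analysis.

Set Implicit Arguments.
Unset Strict Implicit.
Unset Printing Implicit Defensive.

Import Order.TTheory GRing.Theory Num.Theory.
Import numFieldNormedType.Exports.

Local Open Scope classical_set_scope.
Local Open Scope ring_scope.

Record dual (R : realType) (X : normedModType R) := Dual {
  dual_fun :> {linear X -> R^o} ;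
  dual_continuous : continuous dual_fun }.

Section Dual.
Context {R : realType} {X : normedModType R}.
Implicit Types xs : dual X.

Lemma dual_opp_continuous xs : continuous (\- xs : {linear X -> R^o}).
Proof. by move=> x; apply: continuousN; exact: dual_continuous. Qed.

Definition dual_opp xs : dual X := Dual (@dual_opp_continuous xs).

Definition dual_norm xs : R := sup [set `|xs u| | u in [set u | `|u| <= 1]].

End Dual.

Section MinimalTime.
Context {R : realType} {X : normedModType R}.
Implicit Types (Omega F A : set X) (f : X -> \bar R) (x : X) (eps r : R)
  (xs : dual X).
Local Open Scope ereal_scope.

Definition minimal_time Omega F x : \bar R :=
  ereal_inf [set t%:E | t in
    [set t : R | (0 <= t)%R
               /\ ((fun q => x + t *: q)%R @` F) `&` Omega !=set0]].

Definition enlargement Omega F r : set X :=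
  [set x | minimal_time Omega F x <= r%:E].

(* Real-valued, hence meaningful only when F is nonempty and bounded. *)
Definition set_norm F : R := sup [set `|q|%R | q in F].

Definition support_function F xs : \bar R := ereal_sup [set (xs q)%:E | q in F].

Definition S_star F eps : set (dual X) :=
  [set xs | (1 - eps * set_norm F)%:E <= support_function F (dual_opp xs)
          /\ support_function F (dual_opp xs) <= (1 + eps * set_norm F)%:E].

(* If x is isolated in A, then within A x^' contains the empty set and the
   upper limit is -oo: every functional is then an eps-normal. *)
Definition eps_normals eps x A : set (dual X) :=
  [set xs : dual X |
    limf_esup (fun u => (xs (u - x) / `|u - x|)%R%:E) (within A x^')
      <= eps%:E].

Definition eps_frechet_subdiff eps f x : set (dual X) :=
  [set xs : dual X | (- eps)%:E <=
    limf_einf (fun u => (f u - f x - (xs (u - x)%R)%:E)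
                        * (`|(u - x)%R|^-1)%:E) x^'].

End MinimalTime.

(* Main.v *)
Require Import Defs.
From HB Require Import structures.
From mathcomp Require Import all_boot all_order all_algebra.
From mathcomp Require Import all_classical all_reals all_analysis.
From mathcomp Require Import ring lra.
Import Order.TTheory GRing.Theory Num.Theory.
Import numFieldNormedType.Exports.
Local Open Scope classical_set_scope.
Local Open Scope ring_scope.

(** Write [T] for the minimal time function, [h = x - xbar], and [f] for
    [set_norm F].  The task is to bound [xs h] by
    [T x - r + (ell * eps + o(1)) |h|] for [x] near [xbar], whereas the
    normality of [xs] only speaks of points of the sublevel set [T <= r].  The
    link between the two is that moving along a direction of [F] for a time
    [s] lets [T] rise by at most [s], and lets it fall by nearly [s] in a
    suitable direction: each [x] is thus moved into the sublevel set, and the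
    normal inequality is applied there.  The condition [S_star] says that
    [- xs q] is at most [1 + eps f] on [F] and nearly [1 - eps f] or more for
    some [q], so the effect of the motion on [xs] matches, up to [eps f s],
    what [T] gained or lost.

    If [T x <= r], put [s = r - T x].  By convexity of [F] the point
    [x - s q] still satisfies [T <= r] for every [q] in [F]
    ([minimal_time_backward]); taking [q] almost optimal in
    [support_function F (- xs)], normality gives
    [xs h + s (1 - eps f) <= eps (|h| + s f) + o(|h| + s)].
    If [T x = r + s > r], then for some [q] in [F] the point [x + s q] lies
    in the sublevel set up to an arbitrarily small correction [tau]
    ([minimal_time_forward]), and normality gives
    [xs h <= s (1 + eps f) + eps (|h| + s f) + o(|h| + s)].
    Either way the error is [eps |h| + 2 eps f s + o(|h| + s)], which has the
    required form as soon as [s <= K |h|] with [K <= kappa].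

    When [T x > r] and [|xs u| <= M |u|], this linear bound may be assumed
    with the constant [M], since for [s >= M |h|] already [xs h <= s].  When
    [T x <= r] it is the delicate point: [T] need not be lower semicontinuous,
    as [F] is not compact, so [r - T x] is not known in advance to be small.
    The inequality above, applied to shorter moves [s' <= s], rules out a large
    drop because [1 - 2 eps f > 0] ([minimal_time_drop_le]).  This yields
    [K = 2 (eps + 1 + M) / (1 - 2 eps f)]. *)

(** * Moving along the dynamics *)

Lemma minimal_time_ge0 {R : realType} {X : normedModType R} (Omega F : set X)
    (x : X) :
  (0 <= minimal_time Omega F x)%E.
Proof. by apply/ereal_infP => _ [t [t0 _] <-]; rewrite lee_fin. Qed.

Lemma minimal_time_le {R : realType} {X : normedModType R} {Omega F : set X}
    {x q : X} {t : R} :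
  0 <= t -> F q -> Omega (x + t *: q) -> (minimal_time Omega F x <= t%:E)%E.
Proof.
move=> t0 Fq Oq; apply: ereal_inf_lbound; exists t => //; split=> //.
by exists (x + t *: q); split=> //; exists q.
Qed.

Lemma minimal_time_lt {R : realType} {X : normedModType R} {Omega F : set X}
    {x : X} {t : R} :
  (minimal_time Omega F x < t%:E)%E ->
  exists (t' : R) (q : X), [/\ 0 <= t', t' < t, F q & Omega (x + t' *: q)].
Proof.
move=> /ereal_inf_lt[_ [t' [t'0 [_ [[q Fq <-] Oq]]] <-]]; rewrite lte_fin => t't.
by exists t', q.
Qed.

Lemma convex_set_scale_add {R : realType} {X : normedModType R} {F : set X}
    {q q' : X} {s t : R} :
  convex_set (F : set (convex_lmodType X)) -> 0 <= s -> 0 <= t -> F q -> F q' ->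
  exists2 q'', F q'' & s *: q + t *: q' = (s + t) *: q''.
Proof.
move=> Fc s0 t0 Fq Fq'; have [st0|st0] := eqVneq (s + t) 0.
  have [-> ->] : s = 0 /\ t = 0 by split; lra.
  by exists q => //; rewrite addr0 !scale0r addr0.
have st : 0 < s + t by rewrite lt_neqAle eq_sym st0 addr_ge0.
have l0 : 0 <= s / (s + t) by rewrite divr_ge0// ltW.
have l1 : s / (s + t) <= 1 by rewrite ler_pdivrMr// mul1r lerDl.
pose l := Itv01 l0 l1.
exists (conv l (q : convex_lmodType X) (q' : convex_lmodType X)).
  by apply: set_mem; apply: Fc; exact: mem_set.
change (s *: q + t *: q' =
  (s + t) *: ((s / (s + t)) *: q + (1 - s / (s + t)) *: q')).
rewrite scalerDr !scalerA; congr (_ *: _ + _ *: _); by field.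
Qed.

(** Moving back by [s q] costs at most the time [s]: the target can be reached
    by undoing the move first, and convexity merges the two motions, in the
    directions [q] and [q'], into one motion along a single element of [F]. *)
Lemma minimal_time_backward {R : realType} {X : normedModType R}
    {Omega F : set X} {x q : X} {s t : R} :
  convex_set (F : set (convex_lmodType X)) -> F q -> 0 <= s ->
  (minimal_time Omega F x <= t%:E)%E ->
  (minimal_time Omega F (x - s *: q)%R <= (s + t)%:E)%E.
Proof.
move=> Fc Fq s0 Tt; apply/lee_addgt0Pr => e e0.
have /minimal_time_lt[t' [q' [t'0 t't Fq' Oq']]] :
    (minimal_time Omega F x < (t + e)%:E)%E.
  by apply: le_lt_trans Tt _; rewrite lte_fin; lra.
have [q'' Fq'' E] := convex_set_scale_add Fc s0 t'0 Fq Fq'.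
apply: (@le_trans _ _ (s + t')%:E); last by rewrite -EFinD lee_fin; lra.
apply: (minimal_time_le _ Fq''); first exact: addr_ge0.
by rewrite -E addrA subrK.
Qed.

(** The infimum defining the minimal time need not be attained, so only an
    almost optimal direction is available: the remaining time is measured from
    an upper bound [t], not from the minimal time itself. *)
Lemma minimal_time_forward {R : realType} {X : normedModType R}
    {Omega F : set X} {x : X} {s t : R} :
  (minimal_time Omega F x < t%:E)%E -> (s%:E <= minimal_time Omega F x)%E ->
  exists2 q, F q & (minimal_time Omega F (x + s *: q)%R <= (t - s)%:E)%E.
Proof.
move=> /minimal_time_lt[t' [q [t'0 t't Fq Oq]]] sT; exists q => //.
have st' : s <= t' by rewrite -lee_fin (le_trans sT) ?(minimal_time_le t'0 Fq).
apply: (@le_trans _ _ (t' - s)%:E); last by rewrite lee_fin; lra.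
apply: (minimal_time_le _ Fq); first by rewrite subr_ge0.
by rewrite -addrA -scalerDl subrKC.
Qed.

(** * Bounds attached to the dynamics, the functional and its normality *)

Lemma set_norm_ub {R : realType} {X : normedModType R} {F : set X} {q : X} :
  bounded_set F -> F q -> `|q| <= set_norm F.
Proof.
move=> [M [_ FM]] Fq; apply: ub_le_sup; last by exists q.
by exists (M + 1) => _ [p Fp <-]; apply: FM => //; lra.
Qed.

(** A small time with bounded speed covers a small distance, whereas [x] lies
    at a positive distance from the closed set [Omega]. *)
Lemma minimal_time_gt0 {R : realType} {X : normedModType R} {Omega F : set X}
    {x : X} :
  closed Omega -> bounded_set F -> ~ Omega x -> (0 < minimal_time Omega F x)%E.
Proof.
move=> Oc Fb Ox; rewrite lt_neqAle minimal_time_ge0 andbT eq_sym.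
apply/negP => /eqP T0; apply: Ox; apply: Oc => B /nbhs_normP[e /= e0 eB].
have f0 : 0 < 1 + `|set_norm F| by rewrite ltr_pwDl.
have /minimal_time_lt[t [q [t0 te Fq Oq]]] :
    (minimal_time Omega F x < (e / (1 + `|set_norm F|))%:E)%E.
  by rewrite T0 lte_fin divr_gt0.
exists (x + t *: q); split=> //; apply: eB.
rewrite /ball_ /= opprD addNKr normrN normrZ ger0_norm//.
move: te; rewrite ltr_pdivlMr//; apply: le_lt_trans; rewrite ler_wpM2l//.
have := set_norm_ub Fb Fq; have := ler_norm (set_norm F); lra.
Qed.

Lemma dual_bounded {R : realType} {X : normedModType R} (xs : dual X) :
  exists2 M, 0 < M & forall u, `|xs u| <= M * `|u|.
Proof.
have /linear_boundedP/pinfty_ex_gt0[M M0 xsM] : bounded_near xs (nbhs (0 : X)).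
  by apply: continuous_linear_bounded; exact: dual_continuous.
by exists M.
Qed.

(** The upper limit unfolded into an inequality without quotient, which holds
    at [u = x] as well. *)
Lemma eps_normals_ball {R : realType} {X : normedModType R} {A : set X}
    {x : X} {eps : R} {xs : dual X} :
  eps_normals eps x A xs -> forall eta, 0 < eta ->
  exists2 rho, 0 < rho & forall u, A u -> `|u - x| < rho ->
    xs (u - x) <= (eps + eta) * `|u - x|.
Proof.
move=> xsN eta eta0.
have /ereal_inf_lt[_ [V VA <-] Vlt] :
    (limf_esup (fun u => (xs (u - x) / `|u - x|)%R%:E) (within A x^')
      < (eps + eta)%:E)%E.
  by apply: le_lt_trans xsN _; rewrite lte_fin; lra.
have /nbhs_normP[rho /= rho0 rhoV] : nbhs x [set u | u != x -> A u -> V u].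
  by [].
exists rho => // u Au ux.
have [->|nux] := eqVneq u x; first by rewrite subrr linear0 normr0 mulr0.
rewrite -ler_pdivrMr ?normr_gt0 ?subr_eq0// -lee_fin.
apply: le_trans (ltW Vlt); apply: ereal_sup_ubound; exists u => //.
by apply: rhoV => //; rewrite /ball_/= distrC.
Qed.

(** Points where [f] is [+oo] put no constraint on the lower limit, so it
    suffices to test the points with a real value. *)
Lemma eps_frechet_subdiff_ball {R : realType} {X : normedModType R}
    {f : X -> \bar R} {x : X} {r c : R} {xs : dual X} :
  (forall u, (0 <= f u)%E) -> f x = r%:E ->
  (forall e, 0 < e -> exists2 rho, 0 < rho &
    forall u t, `|u - x| < rho -> f u = t%:E ->
      xs (u - x) <= t - r + (c + e) * `|u - x|) ->
  eps_frechet_subdiff c f x xs.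
Proof.
move=> f0 fx H; rewrite /eps_frechet_subdiff /= limf_einfE.
apply/lee_subgt0Pr => e /H[rho rho0 Hrho].
apply: le_trans (ereal_sup_ubound _); last first.
  exists (ball x rho `\ x); first exact: dnbhs_ball.
  by [].
apply/ereal_infP => _ [u [+ /eqP nux] <-].
rewrite -ball_normE /ball_/= distrC => ux.
have d0 : 0 < `|u - x| by rewrite normr_gt0 subr_eq0.
rewrite fx lee_pdivlMr//.
have := f0 u; case E: (f u) => [t| |]//= _.
  by have := Hrho _ _ ux E; rewrite -!EFinD -EFinM lee_fin; lra.
by rewrite leey.
Qed.

Lemma S_star_le {R : realType} {X : normedModType R} {F : set X} {eps : R}
    {xs : dual X} {q : X} :
  S_star F eps xs -> F q -> - xs q <= 1 + eps * set_norm F.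
Proof.
move=> [_ Sle] Fq; rewrite -lee_fin; apply: le_trans Sle.
by apply: ereal_sup_ubound; exists q.
Qed.

Lemma S_star_gt {R : realType} {X : normedModType R} {F : set X} {eps eta : R}
    {xs : dual X} :
  S_star F eps xs -> 0 < eta ->
  exists2 q, F q & 1 - eps * set_norm F - eta < - xs q.
Proof.
move=> [Sge _] eta0.
have /ereal_sup_gt[_ [q Fq <-] qlt] :
    ((1 - eps * set_norm F - eta)%:E < support_function F (dual_opp xs))%E.
  by apply: lt_le_trans Sge; rewrite lte_fin; lra.
by exists q.
Qed.

(** * The two one-sided estimates *)

(** Both cases end with the same error term, [w] being the length of the move
    into the sublevel set.  Its coefficient of [eps] is [d + 2 f w], which is
    where the form [1 + 2 kappa f] of [ell] comes from; [eta * d] absorbs the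
    correction made when the infimum is not attained. *)
Lemma coefficient_bound {R : realType} {eps f K kappa eta e d w : R} :
  0 <= eps -> 0 <= f -> K <= kappa -> 0 <= eta ->
  eta * (2 + K * (1 + f)) <= e -> 0 <= d -> 0 <= w -> w <= K * d ->
  w * (eps * f + eta) + (eps + eta) * (d + w * f) + eta * d <=
    ((1 + 2 * kappa * f) * eps + e) * d.
Proof.
move=> eps0 f0 Kk eta0 etae d0 w0 wK.
have c0 : 0 <= 2 * eps * f + eta * (1 + f).
  by rewrite addr_ge0 ?mulr_ge0// addr_ge0.
have H1 := ler_wpM2r c0 wK.
have H2 := ler_wpM2r d0 etae.
have H3 : 0 <= (kappa - K) * (2 * f * eps * d).
  by rewrite !mulr_ge0// subr_ge0.
lra.
Qed.

(** The first conclusion is a calmness property of the minimal time function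
    that fails for general [xbar]: it is extracted from the existence of an
    [eps]-normal with [S_star].  Gaining time [s] along [q] improves [- xs] by
    about [s (1 - eps f)], normality allows only [eps s f] plus a multiple of
    [|h|], and [1 - 2 eps f > 0] leaves a positive multiple of [s] to be bounded
    by [|h|]. *)
Lemma minimal_time_drop_le {R : realType} {X : normedModType R}
    {Omega F : set X} {eps eta rho M r t : R} {xs : dual X} {xbar x : X} :
  bounded_set F -> convex_set (F : set (convex_lmodType X)) ->
  S_star F eps xs -> 0 <= eps -> 0 < eta -> eta <= 1 ->
  0 < 1 - 2 * eps * set_norm F ->
  2 * (eta * (1 + set_norm F)) <= 1 - 2 * eps * set_norm F ->
  0 < M -> (forall u, `|xs u| <= M * `|u|) ->
  (forall u, enlargement Omega F r u -> `|u - xbar| < rho ->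
    xs (u - xbar) <= (eps + eta) * `|u - xbar|) ->
  let K := 2 * (eps + 1 + M) / (1 - 2 * eps * set_norm F) in
  0 < `|x - xbar| -> (1 + 2 * K * set_norm F) * `|x - xbar| < rho ->
  minimal_time Omega F x = t%:E -> t <= r ->
  r - t <= K * `|x - xbar| /\
  xs (x - xbar) <= t - r + (r - t) * (eps * set_norm F + eta)
    + (eps + eta) * (`|x - xbar| + (r - t) * set_norm F).
Proof.
move=> Fb Fc Sxs eps0 eta0 eta1 D0 etaD M0 xsM xsN K dp xrho Tx tr.
have [q Fq qlt] := S_star_gt Sxs eta0.
have qf := set_norm_ub Fb Fq.
have f0 : 0 <= set_norm F by exact: le_trans qf.
clear Sxs; set f := set_norm F in K D0 etaD xrho f0 qlt qf *.
set d := `|x - xbar| in dp xrho *.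
have d0 : 0 <= d := ltW dp.
(* The normal inequality at [x - s q], for any move short enough to stay in
   the ball where that inequality is known. *)
have key s : 0 <= s -> s <= r - t -> d + s * f < rho ->
    xs (x - xbar) + s * (1 - eps * f - eta) <= (eps + eta) * (d + s * f).
  move=> s0 srt srho.
  have xsE : x - s *: q - xbar = (x - xbar) - s *: q by rewrite addrAC.
  have nle : `|x - s *: q - xbar| <= d + s * f.
    rewrite xsE (le_trans (ler_normB _ _))// lerD2l normrZ ger0_norm//.
    exact: ler_wpM2l.
  have xsL : xs (x - s *: q - xbar) = xs (x - xbar) - s * xs q.
    by rewrite xsE linearB linearZ.
  have Oq : enlargement Omega F r (x - s *: q).
    apply: (@le_trans _ _ (s + t)%:E); last by rewrite lee_fin; lra.
    by apply: minimal_time_backward => //; rewrite Tx.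
  have := xsN _ Oq (le_lt_trans nle srho); rewrite xsL.
  have e0 : 0 <= eps + eta by lra.
  have H1 := ler_wpM2l e0 nle.
  have H2 := ler_wpM2l s0 (ltW qlt).
  lra.
have xsd : - (M * d) <= xs (x - xbar).
  by have := xsM (x - xbar); rewrite ler_norml => /andP[].
have KD : K * (1 - 2 * eps * f) = 2 * (eps + 1 + M).
  by rewrite /K divfK// gt_eqF.
have sK s : 0 <= s -> s <= r - t -> d + s * f < rho -> s <= K * d.
  move=> s0 srt srho; have H := key s s0 srt srho.
  rewrite -(ler_pM2r D0) [leRHS]mulrAC KD.
  have H1 := ler_wpM2l s0 etaD.
  have H2 := ler_wpM2r d0 eta1.
  lra.
have K0 : 0 < K by rewrite divr_gt0//; lra.
have Kd0 : 0 < K * d by rewrite mulr_gt0.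
have rt0 : 0 <= r - t by lra.
have small s : s <= 2 * (K * d) -> d + s * f < rho.
  move=> s2; apply: le_lt_trans xrho.
  have := ler_wpM2r f0 s2; lra.
suff rtK : r - t <= K * d.
  split=> //.
  have rt2 : r - t <= 2 * (K * d) by lra.
  have := key _ rt0 (lexx _) (small _ rt2); lra.
(* A drop larger than [K d] is truncated to at most [2 K d]: the truncated move
   stays in the ball, but its length still exceeds the bound [K d]. *)
rewrite leNgt; apply/negP => ltrt.
pose s := Num.min (r - t) (2 * (K * d)).
have s0 : 0 <= s by rewrite le_min rt0/= mulr_ge0// ltW.
have sr : s <= r - t by rewrite ge_min lexx.
have s2 : s <= 2 * (K * d) by rewrite ge_min lexx orbT.
have := sK s s0 sr (small s s2); rewrite leNgt => /negP; apply.
by rewrite lt_min ltrt/=; lra.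
Qed.

(** The extra time [tau] compensates for the infimum not being attained; the
    moved point is then exactly in the sublevel set, where normality applies. *)
Lemma minimal_time_rise_le {R : realType} {X : normedModType R}
    {Omega F : set X} {eps eta rho r s tau : R} {xs : dual X} {xbar x : X} :
  bounded_set F -> S_star F eps xs -> 0 <= eps -> 0 < eta -> 0 < r ->
  (forall u, enlargement Omega F r u -> `|u - xbar| < rho ->
    xs (u - xbar) <= (eps + eta) * `|u - xbar|) ->
  0 <= s -> 0 < tau -> tau <= r ->
  `|x - xbar| + (s + tau) * set_norm F < rho ->
  minimal_time Omega F x = (r + s)%:E ->
  xs (x - xbar) <= s + tau + (s + tau) * (eps * set_norm F)
    + (eps + eta) * (`|x - xbar| + (s + tau) * set_norm F).
Proof.
move=> Fb Sxs eps0 eta0 r0 xsN s0 tau0 taur xrho Tx.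
have w0 : 0 <= s + tau by lra.
have [q Fq Tq] : exists2 q, F q &
    (minimal_time Omega F (x + (s + tau) *: q)%R
      <= (r + s + tau - (s + tau))%:E)%E.
  apply: minimal_time_forward; first by rewrite Tx lte_fin; lra.
  by rewrite Tx lee_fin; lra.
have Oq : enlargement Omega F r (x + (s + tau) *: q).
  by apply: le_trans Tq _; rewrite lee_fin; lra.
have xE : x + (s + tau) *: q - xbar = (x - xbar) + (s + tau) *: q.
  by rewrite addrAC.
have xsL : xs (x + (s + tau) *: q - xbar) = xs (x - xbar) + (s + tau) * xs q.
  by rewrite xE linearD linearZ.
have nle : `|x + (s + tau) *: q - xbar| <=
    `|x - xbar| + (s + tau) * set_norm F.
  rewrite xE (le_trans (ler_normD _ _))// lerD2l normrZ ger0_norm//.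
  exact: ler_wpM2l w0 _ _ (set_norm_ub Fb Fq).
have e0 : 0 <= eps + eta by lra.
have := xsN _ Oq (le_lt_trans nle xrho); rewrite xsL.
have := ler_wpM2l e0 nle.
have := ler_wpM2l w0 (S_star_le Sxs Fq).
lra.
Qed.

(** * The subdifferential of the minimal time function *)

Theorem theorem5p2 (R : realType) (X : normedModType R) (Omega F : set X)
    (Omega0 : Omega !=set0) (Omega_closed : closed Omega)
    (F0 : F !=set0) (F_closed : closed F) (F_bounded : bounded_set F)
    (F_convex : convex_set (F : set (convex_lmodType X)))
    (F_neq0 : F <> [set 0])
    (xbar : X) (xbar_notin : ~ Omega xbar)
    (r : R) (rE : minimal_time Omega F xbar = r%:E)
    (eps : R) (eps_ge0 : 0 <= eps) (eps_small : 0 < 1 - 2 * eps * set_norm F)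
    (xs : dual X)
    (xs_in : (eps_normals eps xbar (enlargement Omega F r) `&` S_star F eps) xs) :
  exists kappa ell : R,
    [/\ dual_norm xs < kappa,
        ell = 1 + 2 * kappa * set_norm F
      & eps_frechet_subdiff (ell * eps) (minimal_time Omega F) xbar xs].
Proof.
case: xs_in => xsN xsS.
have [M M0 xsM] := dual_bounded xs.
have r0 : 0 < r by rewrite -lte_fin -rE minimal_time_gt0.
have f0 : 0 <= set_norm F.
  by have [q Fq] := F0; exact: le_trans (set_norm_ub F_bounded Fq).
pose K := 2 * (eps + 1 + M) / (1 - 2 * eps * set_norm F).
have K0 : 0 < K by rewrite divr_gt0//; lra.
have epsf0 : 0 <= eps * set_norm F by rewrite mulr_ge0.
have MK : M + 1 <= K by rewrite ler_pdivlMr//; nra.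
(* Increasing [kappa] weakens the conclusion, so [kappa] may be taken to exceed
   both the dual norm and the calmness constant [K]. *)
exists (Num.max (dual_norm xs + 1) K).
exists (1 + 2 * Num.max (dual_norm xs + 1) K * set_norm F); split=> //.
  by rewrite lt_max ltrDl ltr01.
have Kk : K <= Num.max (dual_norm xs + 1) K by rewrite le_max lexx orbT.
apply: (eps_frechet_subdiff_ball _ rE) => [u|e e0]; first exact: minimal_time_ge0.
pose f := set_norm F.
have f1 : 0 < 1 + f by rewrite ltr_pwDl.
have c0 : 0 < 2 + K * (1 + f) by rewrite addr_gt0// mulr_gt0.
(* The three bounds keep half of the margin [1 - 2 eps f] in the calmness
   estimate and keep the total error below [e * d]. *)
pose eta := Num.min 1
  (Num.min ((1 - 2 * eps * f) / (2 * (1 + f))) (e / (2 + K * (1 + f)))).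
have eta0 : 0 < eta by rewrite !lt_min ltr01/= !divr_gt0// mulr_gt0.
have eta1 : eta <= 1 by rewrite ge_min lexx.
have etaD : 2 * (eta * (1 + f)) <= 1 - 2 * eps * f.
  by rewrite mulrCA -ler_pdivlMr ?mulr_gt0// !ge_min lexx orbT.
have etae : eta * (2 + K * (1 + f)) <= e.
  by rewrite -ler_pdivlMr// !ge_min lexx !orbT.
have [rho rho0 xsrho] := eps_normals_ball xsN _ eta0.
have Kf0 : 0 <= K * f by rewrite mulr_ge0 ?(ltW K0).
have c1 : 0 < 1 + 2 * K * f by lra.
exists (rho / (1 + 2 * K * f)); first exact: divr_gt0.
move=> x t; rewrite ltr_pdivlMr// mulrC => xrho Tx.
have [xE|nx] := eqVneq x xbar.
  have -> : t = r by apply: EFin_inj; rewrite -Tx xE rE.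
  by rewrite xE !subrr linear0 normr0 mulr0 addr0.
have d0 : 0 < `|x - xbar| by rewrite normr_gt0 subr_eq0.
have [tr|rt] := leP t r.
  have [rtK xsle] := minimal_time_drop_le F_bounded F_convex xsS eps_ge0 eta0
    eta1 eps_small etaD M0 xsM xsrho d0 xrho Tx tr.
  have rt0 : 0 <= r - t by lra.
  have := coefficient_bound eps_ge0 f0 Kk (ltW eta0) etae (ltW d0) rt0 rtK.
  have := mulr_gt0 eta0 d0; lra.
have xsd : xs (x - xbar) <= M * `|x - xbar|.
  by apply: le_trans (xsM _); exact: ler_norm.
have ell0 :
    0 <= ((1 + 2 * Num.max (dual_norm xs + 1) K * f) * eps + e) * `|x - xbar|.
  rewrite mulr_ge0// addr_ge0 ?(ltW e0)// mulr_ge0// addr_ge0// !mulr_ge0//.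
  exact: le_trans (ltW K0) Kk.
(* If the increase of the minimal time already dominates [xs h], nothing is
   left to prove; otherwise it is at most linear in [|h|]. *)
have [Mle|ltM] := leP (M * `|x - xbar|) (t - r).
  by apply: le_trans xsd _; apply: le_trans Mle _; rewrite lerDl.
pose tau := Num.min r (eta * `|x - xbar|).
have tau0 : 0 < tau by rewrite lt_min r0 mulr_gt0.
have taur : tau <= r by rewrite ge_min lexx.
have taud : tau <= eta * `|x - xbar| by rewrite ge_min lexx orbT.
have w0 : 0 <= t - r + tau by lra.
have wK : t - r + tau <= K * `|x - xbar|.
  have := ler_wpM2r (ltW d0) MK; have := ler_wpM2r (ltW d0) eta1; lra.
have xrho' : `|x - xbar| + (t - r + tau) * set_norm F < rho.
  apply: le_lt_trans xrho; have := ler_wpM2r f0 wK.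
  have := mulr_ge0 (mulr_ge0 (ltW K0) f0) (ltW d0); rewrite /f; lra.
have Tx' : minimal_time Omega F x = (r + (t - r))%:E by rewrite subrKC.
have s0 : 0 <= t - r by lra.
have := minimal_time_rise_le F_bounded xsS eps_ge0 eta0 r0 xsrho s0 tau0 taur
  xrho' Tx'.
have := coefficient_bound eps_ge0 f0 Kk (ltW eta0) etae (ltW d0) w0 wK.
have := mulr_ge0 w0 (ltW eta0); lra.
Qed.
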